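(* Let $g_0=dr^2+h_0^2(r,\theta)\,d\theta^2$ and $g=dr^2+h^2(r,\theta)\,d\theta^2$ be two Riemannian metrics on the surface $M=(a,b)\times N$, where $N$ is either a closed interval of $\mathbb R$ or the circle $\mathbb S^1$, and let $K$, $K_0$ be the Gauss curvatures of $g$ and $g_0$ respectively. Let $m(r,\theta)=-h_0^2\,\partial_r\big(\ln(\tfrac{h}{h_0})\big)$. Then $$\partial_r m=h_0^2\,(K-K_0)+h_0^{-2}m^2 .$$
   Context: $(a,b)$ is a non-empty open interval of $\mathbb R$, $h$ and $h_0$ are positive functions on $M$ (both may depend on $(r,\theta)$), and everything is $C^\infty$. The Gauss curvatures are $K=-\frac{\partial_r^2h}{h}$ and $K_0=-\frac{\partial_r^2h_0}{h_0}$. *)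

(* Defs.v *)
From Stdlib Require Import Reals.
From Coquelicot Require Import Coquelicot.
Open Scope R_scope.

(* The circle is R / 2 PI Z: a function on (a,b) x S^1 is written in the angular
   coordinate theta, which runs over all of R, and is 2 PI-periodic in theta. *)
Inductive fibre : Type :=
  | Segment (c d : R) (lt_cd : c < d)
  | Circle.

Definition in_fibre (N : fibre) (theta : R) : Prop :=
  match N with
  | Segment c d _ => c <= theta <= d
  | Circle => True
  end.

(* The endpoints of (a,b) may be infinite. *)
Definition surface (a b : Rbar) (N : fibre) (r theta : R) : Prop :=
  Rbar_lt a r /\ Rbar_lt r b /\ in_fibre N theta.

Definition descends (a b : Rbar) (N : fibre) (f : R -> R -> R) : Prop :=
  match N with
  | Segment _ _ _ => True
  | Circle =>
      forall r theta, surface a b Circle r theta ->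
        f r (theta + 2 * PI) = f r theta
  end.

(* Smoothness on a manifold with boundary: near every point of the surface, f is
   the restriction of a function that is C^infinity on a neighbourhood of that
   point in R^2. The values of f outside the surface are irrelevant. *)
Definition smooth_on (a b : Rbar) (N : fibre) (f : R -> R -> R) : Prop :=
  descends a b N f /\
  forall r theta, surface a b N r theta ->
    exists F : R -> R -> R,
      locally_2d (fun u v => forall n : nat, ex_diff_n F n u v) r theta /\
      locally_2d (fun u v => surface a b N u v -> F u v = f u v) r theta.

Definition d_r (f : R -> R -> R) (r theta : R) : R :=
  Derive (fun s => f s theta) r.

(* Gauss curvature of the metric dr^2 + h^2(r,theta) dtheta^2. *)
Definition gauss_curvature (h : R -> R -> R) (r theta : R) : R :=
  - (d_r (d_r h) r theta / h r theta).

(* Main.v *)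
Require Import Defs.
From Stdlib Require Import Reals.
From Coquelicot Require Import Coquelicot.
Open Scope R_scope.

(** For fixed [theta] the identity is an ordinary differential computation in
    [r]. The logarithmic derivatives [u = h' / h] and [u0 = h0' / h0] satisfy the
    Riccati equations [u' = - K - u^2] and [u0' = - K0 - u0^2], and
    [m = - h0^2 (u - u0)]. Since [(h0^2)' = 2 h0^2 u0],
<<
    m' = h0^2 (K - K0) + h0^2 (u^2 - u0^2) - 2 h0^2 u0 (u - u0)
       = h0^2 (K - K0) + h0^2 (u - u0)^2,
>>
    and the last square is [m^2 / h0^2].

    The closed form of [m] may be differentiated only because it holds on a
    whole neighbourhood of [r]. This is where openness of [(a,b)] enters: moving
    in the [r] direction stays in the surface even at a boundary point of the
    fibre, so a local smooth extension of [h] agrees with [h] along the whole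
    [r]-segment and has the same [r]-derivatives there. *)

Lemma locally_surface (a b : Rbar) (N : fibre) (r theta : R) :
  surface a b N r theta -> locally r (fun s => surface a b N s theta).
Proof.
  intros (Ha & Hb & Hin).
  generalize (filter_and _ _ (open_Rbar_gt' (Finite r) a Ha)
                (open_Rbar_lt' (Finite r) b Hb)); apply filter_imp.
  intros s [Hsa Hsb]; repeat split; assumption.
Qed.

(** The [r]-slice of a planar neighbourhood; a two-dimensional property is used
    below only through its trace on the line of constant [theta]. *)
Lemma locally_2d_slice (P : R -> R -> Prop) (r theta : R) :
  locally_2d P r theta -> locally r (fun s => P s theta).
Proof.
  intros [eps Heps]; exists eps; intros s Hs.
  apply Heps; [exact Hs |].
  rewrite Rminus_diag, Rabs_R0; apply cond_pos.
Qed.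

(** Regularity of [h] in [r] is inherited from the local smooth extension,
    with which it agrees near every point of the [r]-segment. *)
Lemma smooth_on_ex_derive_r (a b : Rbar) (N : fibre) (h : R -> R -> R)
    (r theta : R) :
  smooth_on a b N h -> surface a b N r theta ->
  ex_derive (fun s => h s theta) r /\ ex_derive (fun s => d_r h s theta) r.
Proof.
  intros [_ Hsmooth] Hr.
  destruct (Hsmooth r theta Hr) as (F & Hdiff & HFh).
  assert (Heq : locally r (fun s => F s theta = h s theta)).
  { generalize (filter_and _ _ (locally_surface _ _ _ _ _ Hr)
                  (locally_2d_slice _ _ _ HFh)).
    apply filter_imp; intros s [Hs HF]; exact (HF Hs). }
  destruct (locally_2d_singleton _ _ _ Hdiff 2%nat)
    as (_ & HF1 & _ & (_ & HF2 & _) & _).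
  split.
  - exact (ex_derive_ext_loc _ _ _ Heq HF1).
  - refine (ex_derive_ext_loc _ _ _ _ HF2).
    generalize (locally_locally _ _ Heq); apply filter_imp.
    intros s Hs; exact (Derive_ext_loc _ _ _ Hs).
Qed.

Lemma Derive_ln_quotient (f g : R -> R) (x : R) :
  ex_derive f x -> ex_derive g x -> 0 < f x -> 0 < g x ->
  Derive (fun s => ln (f s / g s)) x = Derive f x / f x - Derive g x / g x.
Proof.
  intros Hf Hg Hfx Hgx; apply is_derive_unique.
  assert (Hq : 0 < f x / g x) by (apply Rdiv_lt_0_compat; assumption).
  auto_derive.
  - repeat split; auto; apply Rgt_not_eq; assumption.
  - change (fun x0 : R => f x0) with f; change (fun x0 : R => g x0) with g.
    field; split; apply Rgt_not_eq; assumption.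
Qed.

(** The one-variable form of the identity, with [f'] and [g'] given as functions
    so that their own derivatives can be taken. *)
Lemma is_derive_scaled_log_derivative (f g f' g' : R -> R) (x : R) :
  is_derive f x (f' x) -> is_derive g x (g' x) ->
  ex_derive f' x -> ex_derive g' x -> f x <> 0 -> g x <> 0 ->
  is_derive (fun s => - (g s) ^ 2 * (f' s / f s - g' s / g s)) x
    ((g x) ^ 2 * (- (Derive f' x / f x) - - (Derive g' x / g x))
     + / (g x) ^ 2 * (- (g x) ^ 2 * (f' x / f x - g' x / g x)) ^ 2).
Proof.
  intros Hf Hg Hf' Hg' Hfx Hgx.
  assert (Exf : ex_derive f x) by (eexists; exact Hf).
  assert (Exg : ex_derive g x) by (eexists; exact Hg).
  auto_derive.
  - repeat split; assumption.
  - change (fun x0 : R => f' x0) with f'; change (fun x0 : R => g' x0) with g'.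
    change (fun x0 : R => f x0) with f; change (fun x0 : R => g x0) with g.
    rewrite (is_derive_unique _ _ _ Hf), (is_derive_unique _ _ _ Hg).
    field; split; assumption.
Qed.

Theorem lemma2p1 :
  forall (a b : Rbar) (N : fibre) (h h0 : R -> R -> R),
    Rbar_lt a b ->
    smooth_on a b N h ->
    smooth_on a b N h0 ->
    (forall r theta, surface a b N r theta -> 0 < h r theta) ->
    (forall r theta, surface a b N r theta -> 0 < h0 r theta) ->
    let K := gauss_curvature h in
    let K0 := gauss_curvature h0 in
    let m := fun r theta : R =>
      - (h0 r theta) ^ 2 * d_r (fun s t => ln (h s t / h0 s t)) r theta in
    forall r theta, surface a b N r theta ->
      is_derive (fun s => m s theta) r
        ((h0 r theta) ^ 2 * (K r theta - K0 r theta)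
         + / (h0 r theta) ^ 2 * (m r theta) ^ 2).
Proof.
  intros a b N h h0 _ Hh Hh0 Hpos Hpos0 K K0 m r theta Hr.
  assert (Hm : forall s, surface a b N s theta ->
    m s theta = - (h0 s theta) ^ 2 *
      (d_r h s theta / h s theta - d_r h0 s theta / h0 s theta)).
  { intros s Hs; unfold m, d_r.
    rewrite (Derive_ln_quotient (fun s => h s theta) (fun s => h0 s theta)).
    - reflexivity.
    - exact (proj1 (smooth_on_ex_derive_r _ _ _ _ _ _ Hh Hs)).
    - exact (proj1 (smooth_on_ex_derive_r _ _ _ _ _ _ Hh0 Hs)).
    - exact (Hpos _ _ Hs).
    - exact (Hpos0 _ _ Hs). }
  rewrite (Hm r Hr).
  apply (is_derive_ext_loc (fun s => - (h0 s theta) ^ 2 *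
      (d_r h s theta / h s theta - d_r h0 s theta / h0 s theta))).
  { generalize (locally_surface _ _ _ _ _ Hr); apply filter_imp.
    intros s Hs; symmetry; exact (Hm s Hs). }
  destruct (smooth_on_ex_derive_r _ _ _ _ _ _ Hh Hr) as [Dh DDh].
  destruct (smooth_on_ex_derive_r _ _ _ _ _ _ Hh0 Hr) as [Dh0 DDh0].
  apply (is_derive_scaled_log_derivative (fun s => h s theta)
    (fun s => h0 s theta) (fun s => d_r h s theta) (fun s => d_r h0 s theta)).
  - exact (Derive_correct _ _ Dh).
  - exact (Derive_correct _ _ Dh0).
  - exact DDh.
  - exact DDh0.
  - exact (Rgt_not_eq _ _ (Hpos _ _ Hr)).
  - exact (Rgt_not_eq _ _ (Hpos0 _ _ Hr)).
Qed.
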